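(* Suppose that $G$ is a 2-connected graph. Then $G$ admits $\sigma(G)\le 3$ with an optimal spanning tree $T$ if and only if (I) $T$ has diameter at most three ($T$ is a star or double star, which has no inner star-sets); or (II) each inner star-set $S$ of $T$ is a vertex cut of $G$ and for each $S$-component $H$ of $G$, the star-set $S$ is outer in $T\cap H$.
   Context: All graphs are simple and connected. For a spanning tree $T$ of $G$, $d_T(u,v)$ is the distance between $u$ and $v$ in $T$, $\sigma(G,T):=\max_{uv\in E(G)} d_T(u,v)$, and $\sigma(G):=\min\{\sigma(G,T): T \text{ is a spanning tree of } G\}$. A spanning tree $T$ attaining this minimum, i.e. with $\sigma(G,T)=\sigma(G)$, is called an optimal spanning tree. A pendant vertex of a tree is a vertex incident with only one edge of it. A star is a tree of diameter two; a double star is a tree of diameter three. A vertex cut of $G$ is a set $S\subseteq V(G)$ with $G-S$ disconnected. If $S$ is a vertex cut of $G$ and $V_1,\dots,V_k$ are the vertex sets of the components of $G-S$, the induced subgraphs $G[S\cup V_i]$ are called the $S$-components of $G$. For a non-pendant vertex $v$ of $T$, the set $S=\{v\}\cup N_T(v)$ (where $N_T(v)$ is the set of neighbors of $v$ in $T$) is called a star-set of $T$ with center $v$. A vertex $u\in S\setminus\{v\}$ is a contact vertex of $S$ if it is not a pendant vertex of $T$. A star-set $S$ is outer if it has at most one contact vertex, and inner if it has at least two contact vertices. For an $S$-component $H$, $T\cap H$ is the part of $T$ in $H$ (vertex set $V(H)$, edge set $E(T)\cap E(H)$), and ''$S$ is outer in $T\cap H$'' means that $S$ has at most one contact vertex with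 respect to $T\cap H$, i.e. at most one vertex of $S\setminus\{v\}$ is non-pendant in $T\cap H$. *)

(* Defs.v *)
From mathcomp Require Import all_boot.

Set Implicit Arguments.
Unset Strict Implicit.
Unset Printing Implicit Defensive.

(* A graph on the vertex set V is given by its edge set, a set of unordered   *)
(* pairs of vertices. A spanning subgraph is then a subset of the edge set.   *)
Section Graphs.
Variable V : finType.
Implicit Types (E F T : {set {set V}}) (A S C : {set V}) (u v x y : V).

Definition simple_graph E : bool := [forall e in E, #|e| == 2].

Definition adj E : rel V := [rel x y | [set x; y] \in E].

Definition induced E A : {set {set V}} := [set e in E | e \subset A].

(* The empty graph counts as connected, so that S := setT is not a vertex cut *)
(* below. *)
Definition connected_on E A : bool :=
  [forall x in A, forall y in A, connect (adj (induced E A)) x y].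

Definition components E A : {set {set V}} :=
  equivalence_partition (connect (adj (induced E A))) A.

Definition two_connected E : bool :=
  [&& 2 < #|V|, connected_on E [set: V]
    & [forall x, connected_on E (~: [set x])]].

Definition acyclic E : bool :=
  [forall n : 'I_#|V|.+1, forall c : n.-tuple V,
     (2 < n) && uniq c ==> ~~ cycle (adj E) c].

Definition spanning_tree E T : bool :=
  [&& T \subset E, connected_on T [set: V] & acyclic T].

Definition walk_of_length E x y n : bool :=
  [exists p : n.-tuple V, path (adj E) x p && (last x p == y)].

(* Distances in a connected graph are less than #|V|; the default value #|V|  *)
(* is only reached by pairs of vertices that are not connected.               *)
Definition dist E x y : nat :=
  \big[minn/#|V|]_(n < #|V| | walk_of_length E x y n) n.

Definition diam T : nat := \max_(p : V * V) dist T p.1 p.2.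

Definition stretch E T : nat := \max_(p : V * V | adj E p.1 p.2) dist T p.1 p.2.

(* The default value #|V| exceeds stretch E T for every spanning tree T, so   *)
(* it plays no role when E is connected.                                      *)
Definition sigma E : nat :=
  \big[minn/#|V|]_(T : {set {set V}} | spanning_tree E T) stretch E T.

Definition optimal E T : bool := spanning_tree E T && (stretch E T == sigma E).

Definition star T : bool := diam T == 2.
Definition double_star T : bool := diam T == 3.

Definition pendant F x : bool := #|[set e in F | x \in e]| == 1.

Definition vertex_cut E S : bool := ~~ connected_on E (~: S).

(* Only considered for a non-pendant vertex v of T. *)
Definition star_set T v : {set V} := v |: [set u | adj T v u].

(* The star-set S, with center v, is kept separate from the graph F in which  *)
(* pendant vertices are computed: F is T itself or T :&: H for an S-component *)
(* H, while S is always taken in T.                                           *)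
Definition contacts F S v : {set V} := [set u in S :\ v | ~~ pendant F u].
Definition outer F S v : bool := #|contacts F S v| <= 1.
Definition inner F S v : bool := 2 <= #|contacts F S v|.

Definition inner_star_set T S v : Prop :=
  [/\ ~~ pendant T v, S = star_set T v & inner T S v].

(* Edge set of the S-component of E given by the component C of E - S. *)
Definition S_component E S C : {set {set V}} := induced E (S :|: C).

Definition condition_I T : Prop := diam T <= 3.

Definition condition_II E T : Prop :=
  forall S v, inner_star_set T S v ->
    vertex_cut E S /\
    (forall C, C \in components E (~: S) ->
       outer (T :&: S_component E S C) S v).

End Graphs.

(* Main.v *)
(* If an edge of G joins two vertices outside a star-set S with center v and  *)
(* its ends are at distance at most 3 in T, then the T-path between them      *)
(* avoids v, since reaching v takes at least two steps from either end. Hence *)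
(* for stretch at most 3 each component of G - S lies in a single component   *)
(* of T - v, and each of the latter has exactly one neighbor of v. Conversely *)
(* an edge xy stretched to a T-path x, a, c, b, d, ..., y makes a and b       *)
(* contact vertices of the star-set of c within one S-component.              *)
Require Import Defs.
From mathcomp Require Import all_boot.

Set Implicit Arguments.
Unset Strict Implicit.
Unset Printing Implicit Defensive.

(** For a fixed spanning tree T, [stretch3P] shows that stretch at most 3 is equivalent to (I) or
    (II); the claims about [sigma] and optimal trees follow because [sigma] is a minimum of
    stretches or its default [#|V|]. Call the components of T - v branches; each contains one
    neighbor of v ([acyclic_branch]). A contact vertex of a star-set S has a tree neighbor outside S
    in its own branch ([contact_witness]). If the stretch is at most 3, a component of G - S stays
    inside one branch ([stretch3_component_branch]). So the witnesses of two contacts lie in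
    different components of G - S: S is a cut, and no S-component keeps both contacts non-pendant.
    Conversely, [condition_II_stretch3] takes an edge whose tree path has at least four edges and
    centers a star-set at the third vertex of that path. *)

Section BigMinn.
Variables (I : eqType) (d : nat) (P : pred I) (F : I -> nat).
Implicit Type r : seq I.

Lemma bigminn_le r i : i \in r -> P i -> \big[minn/d]_(j <- r | P j) F j <= F i.
Proof.
elim: r => // j r IHr; rewrite inE big_cons => /predU1P[<- -> | ri Pi].
  exact: geq_minl.
by case: ifP => _; rewrite ?geq_min IHr ?orbT.
Qed.

(** [minn] always returns one of its arguments, so the property is preserved along the fold. *)
Lemma bigminn_attained r (m := \big[minn/d]_(j <- r | P j) F j) :
  m = d \/ exists2 i, P i & F i = m.
Proof.
rewrite /m; apply: (big_ind (fun k => k = d \/ exists2 i, P i & F i = k)).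
- by left.
- by move=> k l ? ?; rewrite /minn; case: ifP.
- by move=> i Pi; right; exists i.
Qed.

End BigMinn.

Section Graphs.
Variable V : finType.
Implicit Types (E F T : {set {set V}}) (A S C : {set V}).
Implicit Types (a b c u v w x y z : V) (p q : seq V).

Lemma adjC E : symmetric (adj E).
Proof. by move=> x y; rewrite /adj /= setUC. Qed.

Lemma adj_sub F E : F \subset E -> subrel (adj F) (adj E).
Proof. by move=> /subsetP sFE x y; apply: sFE. Qed.

Lemma simple_sub F E : F \subset E -> simple_graph E -> simple_graph F.
Proof.
move=> /subsetP sFE /forall_inP simE.
by apply/forall_inP => e /sFE/simE.
Qed.

Lemma adj_neq E x y : simple_graph E -> adj E x y -> x != y.
Proof. by move=> /forall_inP simE /simE; rewrite cards2; case: (x != y). Qed.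

Lemma adj_induced E A x y :
  adj (induced E A) x y = [&& adj E x y, x \in A & y \in A].
Proof. by rewrite /adj /= inE subUset !sub1set. Qed.

Lemma path_induced E A x p : x \in A ->
  path (adj (induced E A)) x p = path (adj E) x p && all [in A] p.
Proof.
elim: p x => //= y p IHp x Ax; rewrite adj_induced Ax /=.
case: (boolP (y \in A)) => [Ay | _]; last by rewrite !andbF.
by rewrite IHp // andbT andbA.
Qed.

Lemma connect_adjC E : connect_sym (adj E).
Proof. by apply: sym_connect_sym; apply: adjC. Qed.

Lemma connected_onT_connect E x y : connected_on E [set: V] -> connect (adj E) x y.
Proof.
move=> /forall_inP/(_ x (in_setT x))/forall_inP/(_ y (in_setT y)).
apply: connect_sub => u w; rewrite adj_induced !inE !andbT.
exact: connect1.
Qed.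

(** * Acyclic edge sets and branches at a vertex *)

Lemma acyclic_cycle T p :
  acyclic T -> 2 < size p -> uniq p -> ~~ cycle (adj T) p.
Proof.
move=> /forallP acT p_gt2 Up; have p_ltV : size p < #|V|.+1.
  by rewrite ltnS -(card_uniqP Up) max_card.
have /forallP/(_ (in_tuple p)) := acT (Ordinal p_ltV).
by rewrite p_gt2 Up.
Qed.

(** Such an edge would close the path into a cycle; [1 < size p] gives this cycle at least three
    vertices. *)
Lemma acyclic_nochord T x p : acyclic T -> path (adj T) x p ->
  uniq (x :: p) -> 1 < size p -> ~~ adj T x (last x p).
Proof.
move=> acT xp Up p_gt1; have := acyclic_cycle acT (p := x :: p).
by rewrite /= rcons_path xp adjC; apply.
Qed.

(** Otherwise a simple path from a to b avoiding v would close up through v into a cycle. *)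
Lemma acyclic_branch T v a b : acyclic T -> simple_graph T ->
  adj T v a -> adj T v b -> connect (adj (induced T [set~ v])) a b -> a = b.
Proof.
move=> acT simT va vb /connectP[q aq eb]; move: vb; rewrite {b}eb.
case/shortenP: aq => p ap Up _ vb; apply/eqP/negPn/negP => neq_ab.
have nva : a \in [set~ v] by rewrite !inE eq_sym (adj_neq simT va).
move: ap; rewrite path_induced // => /andP[ap /allP vp].
have nvp : v \notin a :: p.
  by apply/negP; rewrite inE eq_sym => /predU1P[eav | /vp]; move: nva;
     rewrite ?eav !inE eqxx.
have := acyclic_nochord (x := v) (p := a :: p) acT.
rewrite /= va ap -/(uniq (a :: p)) nvp Up => /(_ isT isT).
by case: p vb neq_ab {ap Up vp nvp} => [|y p] /= vb; rewrite ?eqxx ?vb // => _ /(_ isT).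
Qed.

(** * Pendant vertices *)

Lemma pendantN F u v w : adj F u v -> adj F u w -> v != w -> ~~ pendant F u.
Proof.
move=> uv uw neq_vw; apply/cards1P => -[e Fe].
have /set1P e_uv : [set u; v] \in [set e] by rewrite -Fe inE set21 andbT.
have /set1P e_uw : [set u; w] \in [set e] by rewrite -Fe inE set21 andbT.
have := set22 u w; rewrite e_uw -e_uv !inE [w == v]eq_sym (negPf neq_vw) orbF.
move/eqP=> ewu; have := set22 u v; rewrite e_uv -e_uw ewu !inE orbb -ewu.
by rewrite (negPf neq_vw).
Qed.

Lemma nonpendant_adj F u v : simple_graph F -> adj F u v -> ~~ pendant F u ->
  exists2 w, w != v & adj F u w.
Proof.
move=> /forall_inP simF uv; rewrite /pendant.
set D := [set e in F | u \in e] => D_neq1.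
have Duv : [set u; v] \in D by rewrite inE set21 andbT.
have /card_gt1P[e1 [e2 [De1 De2 neq12]]] : 1 < #|D|.
  by move: D_neq1; rewrite (cardsD1 [set u; v]) Duv; case: #|_|.
have [e De neq_e] : exists2 e, e \in D & e != [set u; v].
  by case: (eqVneq e1 [set u; v]) neq12 => [-> | ? _];
     [exists e2; rewrite 1?eq_sym | exists e1].
move: De; rewrite inE => /andP[Fe ue].
have /cards2P[y [z [neq_yz e_yz]]] := simF e Fe.
wlog euy : y z neq_yz e_yz / u = y.
  move=> IH; move: (ue); rewrite e_yz !inE => /orP[]/eqP euz.
    exact: (IH y z).
  by apply: (IH z y); rewrite 1?eq_sym // setUC.
exists z; first by apply: contraNneq neq_e => <-; rewrite e_yz euy.
by rewrite /adj /= euy -e_yz.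
Qed.

(** * Distances and their default values *)

Lemma dist_le E p x : path (adj E) x p -> size p < #|V| ->
  dist E x (last x p) <= size p.
Proof.
move=> xp p_ltV; apply: (@bigminn_le _ _ _ _ _ (Ordinal p_ltV)).
  by rewrite mem_index_enum.
by apply/existsP; exists (in_tuple p); rewrite xp eqxx.
Qed.

Lemma dist_attained E x y :
  dist E x y = #|V|
    \/ exists2 i : 'I_#|V|, walk_of_length E x y i & val i = dist E x y.
Proof. exact: bigminn_attained. Qed.

Lemma sigma_attained E :
  sigma E = #|V| \/ exists2 T, spanning_tree E T & stretch E T = sigma E.
Proof. exact: bigminn_attained. Qed.

Lemma dist_le_card E x y : dist E x y <= #|V|.
Proof.
by case: (dist_attained E x y) => [-> // | [i _ <-]]; exact: ltnW (ltn_ord i).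
Qed.

(** A simple path has fewer than [#|V|] edges, so the distance of a connected pair is not the
    default value and is realized by a walk. *)
Lemma geodesic_exists E x y : connect (adj E) x y ->
  exists p, [/\ path (adj E) x p, last x p = y & size p = dist E x y].
Proof.
move=> /connectP[q xq ->{y}]; case/shortenP: xq => p xp Up _.
have p_ltV : size p < #|V| by rewrite -[(size p).+1](card_uniqP Up) max_card.
have := dist_le xp p_ltV.
have [-> | [i /existsP[t /andP[xt /eqP t_last]] <- _]] :=
  dist_attained E x (last x p); first by rewrite leqNgt p_ltV.
by exists t; rewrite size_tuple.
Qed.

Lemma stretch_le_diam E T : stretch E T <= diam T.
Proof. by apply/bigmax_leqP => i _; apply: leq_bigmax. Qed.

Lemma dist_le_diam T x y : dist T x y <= diam T.
Proof. exact: (leq_bigmax (F := fun i : V * V => dist T i.1 i.2) (x, y)). Qed.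

(** An inclusion-minimal connected spanning edge set is acyclic, since an edge of a cycle could be
    removed without disconnecting it. *)
Lemma spanning_tree_exists E :
  connected_on E [set: V] -> exists T, spanning_tree E T.
Proof.
move=> cE; pose P T := (T \subset E) && connected_on T [set: V].
have [T /minsetP[/andP[sTE cT] minT]] : {T | minset P T}.
  by apply: ex_minset; exists E; rewrite /P subxx.
exists T; rewrite /spanning_tree sTE cT; apply/forallP => n; apply/forallP => t.
apply/implyP; case/andP; case: t => -[|x [|y [|z s]]] /= /eqP <- // _.
rewrite /= !inE !negb_or -!andbA; case/and5P => neq_xy neq_xz xs neq_yz.
case/and3P=> ys zs Us; apply/negP=> /and3P[Txy Tyz zx].
pose T' := T :\ [set x; y].
have adjT' u w : u != y -> w != y -> adj T u w -> adj T' u w.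
  move=> uy wy Tuw; rewrite /adj /= in_setD1 [_ \in T]Tuw andbT.
  by apply: contraTneq (set22 x y) => <-; rewrite !inE ![y == _]eq_sym negb_or uy.
(* The rest of the cycle, from y through z and s back to x, bypasses the removed edge; past z it
   never meets y, so [adjT'] applies. *)
have T'yx : connect (adj T') y x.
  apply: (@connect_trans _ _ z).
    apply: connect1; rewrite /adj /= in_setD1 [_ \in T]Tyz andbT.
    apply: contraTneq (set22 y z) => ->.
    by rewrite !inE negb_or ![z == _]eq_sym neq_xz.
  apply/connectP; exists (rcons s x); last by rewrite last_rcons.
  apply: (@sub_in_path _ (predC1 y)) zx => [u w uy wy|]; first exact: adjT'.
  rewrite /= all_rcons /= eq_sym neq_yz neq_xy; apply/allP => u su /=.
  by apply: contraNneq ys => <-.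
have sub : subrel (adj T) (connect (adj T')).
  move=> u w Tuw; have [euw | neq] := eqVneq [set u; w] [set x; y]; last first.
    by apply: connect1; rewrite /adj /= in_setD1 neq.
  move: (set21 u w) (set22 u w); rewrite euw !inE.
  by case/orP=> /eqP-> /orP[]/eqP-> //; rewrite connect_adjC.
have cT' : connected_on T' [set: V].
  apply/forall_inP => u _; apply/forall_inP => w _.
  have := connect_sub sub (connected_onT_connect u w cT).
  apply: connect_sub => a b T'ab; apply: connect1.
  by rewrite adj_induced T'ab !inE.
have : T' = T.
  apply: minT; last exact: subsetDl.
  by rewrite /P cT' (subset_trans (subsetDl _ _) sTE).
by move/setP/(_ [set x; y]); rewrite in_setD1 eqxx [RHS]Txy.
Qed.

(** * Star-sets and the branches at their center *)

(** A walk through v would need at least two steps on each side of v, hence at least four edges. *)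
Lemma short_walk_avoids_center T v x p :
    path (adj T) x p -> size p <= 3 ->
    x \notin star_set T v -> last x p \notin star_set T v ->
  connect (adj (induced T [set~ v])) x (last x p).
Proof.
rewrite /star_set !inE !negb_or => xp p_le3 /andP[xv vx] /andP[yv vy].
apply/connectP; exists p => //; rewrite path_induced ?inE // xp /=.
case: p xp p_le3 yv vy => [|a [|b [|c [|//]]]] //=; rewrite !inE !andbT.
- by move=> _ _ ->.
- move=> /andP[xa ab] _ -> _; rewrite andbT.
  by apply: contraNneq vx => <-; rewrite adjC.
- move=> /and3P[xa ab bc] _ -> vc; rewrite andbT; apply/andP; split.
    by apply: contraNneq vx => <-; rewrite adjC.
  by apply: contraNneq vc => <-.
Qed.

(** The witness is a second neighbor of u inside A; it is not in S, since an edge from it to v would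
    give a triangle. Taking A to be all vertices, or an S-component, serves the two halves of
    (II). *)
Lemma contact_witness T A S v u :
    simple_graph T -> acyclic T -> S = star_set T v -> S \subset A ->
    u \in contacts (induced T A) S v ->
  exists w, [/\ w \in A, w \notin S, adj T v u
              & connect (adj (induced T [set~ v])) u w].
Proof.
move=> simT acT -> sSA; rewrite !inE -andbA => /and3P[neq_uv].
rewrite (negPf neq_uv) /= => vu npu.
have sinT : simple_graph (induced T A).
  by apply: simple_sub simT; apply/subsetP => e; rewrite inE => /andP[].
have Av : v \in A by apply: (subsetP sSA); rewrite !inE eqxx.
have Au : u \in A by apply: (subsetP sSA); rewrite !inE vu orbT.
have uv : adj (induced T A) u v by rewrite adj_induced adjC vu Au Av.
have [w neq_wv] := nonpendant_adj sinT uv npu.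
rewrite adj_induced => /and3P[uw _ Aw]; exists w; split => //.
  rewrite !inE negb_or neq_wv /=.
  have := acyclic_nochord (x := v) (p := [:: u; w]) acT.
  rewrite /= vu uw !inE negb_or ![v == _]eq_sym neq_uv neq_wv (adj_neq simT uw).
  by apply.
by apply: connect1; rewrite adj_induced uw !inE neq_uv.
Qed.

(* A disconnected pair has [dist] equal to #|V|, which can be at most 3, so   *)
(* the connectedness of T is needed to obtain a genuine walk.                 *)
Lemma dist3_avoids_center T v x y :
    connected_on T [set: V] -> dist T x y <= 3 ->
    x \notin star_set T v -> y \notin star_set T v ->
  connect (adj (induced T [set~ v])) x y.
Proof.
move=> cT; have [p [xp <- <-]] := geodesic_exists (connected_onT_connect x y cT).
by move=> *; apply: short_walk_avoids_center.
Qed.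

(** It suffices to treat a single edge of G - S: its ends are at tree distance at most 3. *)
Lemma stretch3_component_branch E T v :
    connected_on T [set: V] -> stretch E T <= 3 ->
  subrel (connect (adj (induced E (~: star_set T v))))
         (connect (adj (induced T [set~ v]))).
Proof.
move=> cT /bigmax_leqP T3; apply: connect_sub => x y.
rewrite adj_induced ![_ \in ~: _]in_setC => /and3P[Exy Sx Sy].
exact/dist3_avoids_center/Sy/Sx/(T3 (x, y)).
Qed.

(** Each of two contacts has a witness in its own branch, and distinct neighbors of v lie in
    distinct branches. *)
Lemma inner_star_witness T S v :
    simple_graph T -> acyclic T -> inner_star_set T S v ->
  exists x y, [/\ x \notin S, y \notin S
                & ~~ connect (adj (induced T [set~ v])) x y].
Proof.
move=> simT acT [_ defS /card_gt1P[a [b [Sa Sb neq_ab]]]].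
have TT : T = induced T [set: V] by apply/setP=> e; rewrite inE subsetT andbT.
move: Sa Sb; rewrite {1 2}TT => Sa Sb.
have [x [_ Sx va ax]] := contact_witness simT acT defS (subsetT S) Sa.
have [y [_ Sy vb b_y]] := contact_witness simT acT defS (subsetT S) Sb.
exists x, y; split=> //; apply: contra neq_ab => xy; apply/eqP.
apply: (acyclic_branch acT simT va vb).
apply: connect_trans ax (connect_trans xy _).
by rewrite connect_adjC.
Qed.

(** * Stretch at most 3 versus conditions (I) and (II) *)

Lemma stretch3_condition_II E T : simple_graph E -> spanning_tree E T ->
  stretch E T <= 3 -> condition_II E T.
Proof.
move=> simE /and3P[sTE cT acT] T3 S v innS; have simT := simple_sub sTE simE.
have defS : S = star_set T v by case: innS.
have branch := stretch3_component_branch (v := v) cT T3; split.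
  have [x [y [Sx Sy xy]]] := inner_star_witness simT acT innS.
  apply: contra xy => /forall_inP/(_ x); rewrite inE Sx => /(_ isT).
  by move=> /forall_inP/(_ y); rewrite inE Sy defS => /(_ isT)/branch.
move=> _ /imsetP[x0 _ ->]; set C := [set y in _ | _].
rewrite /outer leqNgt; apply/card_gt1P => -[a [b []]].
have -> : T :&: S_component E S C = induced T (S :|: C).
  apply/setP=> e; rewrite !inE; case: (boolP (e \in T)) => //= Te.
  by rewrite (subsetP sTE).
move=> Sa Sb /eqP[]; have sSA := subsetUl S C.
have [x [Ax Sx va ax]] := contact_witness simT acT defS sSA Sa.
have [y [Ay Sy vb b_y]] := contact_witness simT acT defS sSA Sb.
apply: (acyclic_branch acT simT va vb).
(* Both witnesses lie in the component C of [x0], hence in one branch, which forces a = b. *)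
move: Ax Ay; rewrite in_setU (negPf Sx) in_setU (negPf Sy) !inE /= defS.
move=> /andP[_ /branch x0x] /andP[_ /branch x0y].
apply: connect_trans ax _; apply: (@connect_trans _ _ x0).
  by rewrite connect_adjC.
by apply: connect_trans x0y _; rewrite connect_adjC.
Qed.

Lemma condition_II_stretch3 E T : spanning_tree E T ->
  condition_II E T -> stretch E T <= 3.
Proof.
move=> /and3P[sTE cT acT] T_II; apply/bigmax_leqP => -[x y] /= Exy.
have /connectP[q xq ey] := connected_onT_connect x y cT.
case/shortenP: xq ey => p xp Up _ ey.
have p_ltV : size p < #|V| by rewrite -[(size p).+1](card_uniqP Up) max_card.
have := dist_le xp p_ltV; rewrite -ey => /leq_trans; apply.
rewrite leqNgt; apply/negP => p_gt3; move: p_gt3 xp Up ey {p_ltV}.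
case: p => [|a [|c [|b [|d p]]]] //= _ /and5P[xa ac cb bd dp].
rewrite -/(uniq (d :: p)) => /and5P[].
rewrite !inE !negb_or => /and5P[nxa nxc nxb nxd xp].
move=> /and4P[nac nab nad ap] /and3P[ncb ncd cp] /andP[nbd bp] Up ey.
pose S := star_set T c.
have Sa : a \in S by rewrite !inE adjC ac orbT.
have Sb : b \in S by rewrite !inE cb orbT.
have Sc : c \in S by rewrite !inE eqxx.
have Sx : x \notin S.
  rewrite !inE negb_or nxc adjC.
  apply: (acyclic_nochord (p := [:: a; c]) acT) => //=; first by rewrite xa ac.
  by rewrite !inE negb_or nxa nxc nac.
(* The part of the tree path after b misses S: an edge from c to z would be a chord of the segment
   from c to z. *)
have outS z : z \in d :: p -> z \notin S.
  move=> pz; have nzc : z != c.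
    by apply: contraTneq pz => ->; rewrite inE negb_or ncd.
  rewrite !inE negb_or nzc.
  have cdp : path (adj T) c (b :: d :: p) by rewrite /= cb bd.
  have Ucdp : uniq (c :: b :: d :: p).
    by rewrite 2!cons_uniq !inE !negb_or ncb ncd cp nbd bp.
  move: cdp Ucdp; case/path.splitP: pz => p1 p2; rewrite -cat_cons cat_path.
  case/andP=> cp1 _; rewrite -cat_cons cat_uniq => /andP[Up1 _].
  have := acyclic_nochord acT cp1 Up1.
  by rewrite /= last_rcons size_rcons; apply.
pose G := induced E (~: S); pose C := [set z in ~: S | connect (adj G) x z].
have Cx : x \in C by rewrite in_set in_setC Sx connect0.
(* From x to d outside S: cross the edge xy, then follow the tree path back from y. *)
have Cd : d \in C.
  have Sd : d \in ~: S by rewrite in_setC outS ?mem_head.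
  rewrite in_set Sd; apply: (@connect_trans _ _ y).
    by apply: connect1; rewrite adj_induced [adj _ _ _]Exy !in_setC Sx ey outS ?mem_last.
  rewrite connect_adjC; apply/connectP; exists p => //.
  rewrite path_induced // (sub_path (adj_sub sTE)) //.
  by apply/allP => z pz; rewrite in_setC outS // inE pz orbT.
have compC : C \in components E (~: S) by apply: imset_f; rewrite in_setC.
have innS : inner_star_set T S c.
  split=> //; first by apply: (pendantN (v := a) (w := b)) => //; rewrite adjC.
  apply/card_gt1P; exists a, b; split=> //.
    rewrite in_set in_setD1 nac Sa.
    by apply: (pendantN (v := x) (w := c)) => //; rewrite adjC.
  rewrite in_set in_setD1 eq_sym ncb Sb.
  by apply: (pendantN (v := c) (w := d)) => //; rewrite adjC.
have [_ /(_ C compC)] := T_II S c innS.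
rewrite /outer leqNgt => /card_gt1P[]; pose A := S :|: C.
have adjH u w : u \in A -> w \in A -> adj T u w -> adj (T :&: S_component E S C) u w.
  move=> Au Aw Tuw; rewrite /adj /= in_setI [_ \in T]Tuw.
  by have := adj_induced E A u w; rewrite Au Aw (adj_sub sTE Tuw).
have AS u : u \in S -> u \in A by move=> Su; rewrite inE Su.
have AC u : u \in C -> u \in A by move=> Cu; rewrite inE Cu orbT.
(* Since x and d lie in C, a keeps the neighbors x and c, and b keeps c and d, within this
   S-component. *)
exists a, b; split=> //.
  rewrite in_set in_setD1 nac Sa.
  by apply: (pendantN (v := x) (w := c)) => //; apply: adjH; auto; rewrite adjC.
rewrite in_set in_setD1 eq_sym ncb Sb.
by apply: (pendantN (v := c) (w := d)) => //; apply: adjH; auto; rewrite adjC.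
Qed.

(** Small stretch always yields (II); under (I) the diameter bounds the stretch. *)
Lemma stretch3P E T : simple_graph E -> spanning_tree E T ->
  stretch E T <= 3 <-> condition_I T \/ condition_II E T.
Proof.
move=> simE tT; split=> [T3 | [T_I | T_II]].
- by right; apply: stretch3_condition_II.
- exact: leq_trans (stretch_le_diam E T) T_I.
- exact: condition_II_stretch3.
Qed.

(** * Trees of diameter at most three *)

(** With diameter at most 1 any three vertices would form a triangle. *)
Lemma acyclic_diam_gt1 T : 2 < #|V| -> acyclic T -> connected_on T [set: V] ->
  1 < diam T.
Proof.
move=> /card_gt2P[x [y [z [_ [neq_xy neq_yz neq_zx]]]]] acT cT.
rewrite ltnNge; apply/negP => dT.
have adjT u w : u != w -> adj T u w.
  have [p [up ew sp]] := geodesic_exists (connected_onT_connect u w cT).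
  have := leq_trans (dist_le_diam T u w) dT; rewrite -sp.
  case: p up ew {sp} => [|v [|//]] /=; first by move=> _ ->; rewrite eqxx.
  by rewrite andbT => uv <-.
have := acyclic_nochord (x := x) (p := [:: y; z]) acT.
rewrite /= !adjT // 1?eq_sym // !inE negb_or neq_xy [x == z]eq_sym neq_zx neq_yz.
by move=> /(_ isT isT isT).
Qed.

(** An inner star-set provides two vertices outside it in different branches, hence at distance more
    than 3. *)
Lemma condition_I_no_inner T S v :
    simple_graph T -> acyclic T -> connected_on T [set: V] ->
  condition_I T -> ~ inner_star_set T S v.
Proof.
move=> simT acT cT T_I innS; have defS : S = star_set T v by case: innS.
have [x [y [Sx Sy /negP]]] := inner_star_witness simT acT innS; apply.
rewrite defS in Sx Sy; apply: dist3_avoids_center => //.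
exact: leq_trans (dist_le_diam T x y) T_I.
Qed.

End Graphs.

Theorem theorem3p2 (V : finType) (E : {set {set V}})
    (simpleE : simple_graph E) (conn2E : two_connected E) :
  [/\ forall T : {set {set V}}, optimal E T ->
        (sigma E <= 3 <-> condition_I T \/ condition_II E T),
      sigma E <= 3 <->
        (exists2 T : {set {set V}},
           spanning_tree E T & condition_I T \/ condition_II E T)
    & forall T : {set {set V}}, spanning_tree E T -> condition_I T ->
        (star T \/ double_star T) /\
        (forall (S : {set V}) (v : V), ~ inner_star_set T S v)].
Proof.
have /and3P[V_gt2 cE _] := conn2E; split.
- by move=> T /andP[tT /eqP <-]; apply: stretch3P.
- split=> [|[T tT /(stretch3P simpleE tT)]]; last first.
    by apply: leq_trans; apply: bigminn_le; rewrite ?mem_index_enum.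
  have [-> V_le3 | [T tT <-]] := sigma_attained E.
    (* If [sigma E] is the default [#|V|], then [#|V|] is at most 3 and bounds all distances, so any
       spanning tree satisfies (I). *)
    have [T tT] := spanning_tree_exists cE; exists T => //; left.
    by apply/bigmax_leqP => i _; apply: leq_trans (dist_le_card _ _ _) V_le3.
  by move/(stretch3P simpleE tT) => ?; exists T.
- move=> T /and3P[sTE cT acT] T_I; split=> [|S v]; last first.
    exact: condition_I_no_inner (simple_sub sTE simpleE) acT cT T_I.
  have := acyclic_diam_gt1 V_gt2 acT cT; move: T_I.
  rewrite /condition_I /star /double_star.
  by case: (diam T) => [|[|[|[|]]]] // _ _; [left | right].
Qed.
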